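(* Let $X,Y$ be Polish spaces, $\mathbb{P}\in\mathcal{P}(X\times Y)$, and let $\mu\in\mathcal{P}(X)$, $\nu\in\mathcal{P}(Y)$ be absolutely continuous with respect to the $X$-marginal and the $Y$-marginal of $\mathbb{P}$, respectively. Let $h:[0,\infty)\to(-\infty,\infty)$ be strictly convex, bounded from below, and continuously differentiable, with $\lim_{x\to 0}h'(x)=0$, $\lim_{x\to+\infty}h'(x)=+\infty$, and $h(2x)\le a\,h(x)+bx+c$ for all $x\ge 0$, for some constants $a,b,c$. Suppose that $\mathbb{Q}^*\in\mathrm{cpl}(\mu,\nu)$ is absolutely continuous with respect to $\mathbb{P}$, with $$h'\circ\frac{d\mathbb{Q}^*}{d\mathbb{P}}(x,y)=(\phi(x)+\psi(y))_+\qquad\mathbb{P}\text{-a.s.}$$ for some measurable $\phi:X\to[-\infty,+\infty)$ and $\psi:Y\to[-\infty,+\infty)$. Then $\mathbb{Q}^*$ is optimal for the problem $$\inf\left\{\int_{X\times Y}h\Big(\frac{d\mathbb{Q}}{d\mathbb{P}}(x,y)\Big)\,\mathbb{P}(dx,dy):\ \mathbb{Q}\in\mathrm{cpl}(\mu,\nu)\right\}.$$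
   Context: $\mathcal{P}(\cdot)$ denotes the set of Borel probability measures. $\mathrm{cpl}(\mu,\nu)$ is the set of Borel probability measures on $X\times Y$ with $X$-marginal $\mu$ and $Y$-marginal $\nu$. The objective functional is understood to be $+\infty$ when $\mathbb{Q}\not\ll\mathbb{P}$. $a_+:=\max(a,0)$, with $(-\infty)_+=0$. The value $h'(0)$ is $\lim_{x\searrow 0}h'(x)=0$. *)

(* Defs.v *)
From HB Require Import structures.
From mathcomp Require Import all_boot all_order all_algebra.
From mathcomp Require Import all_classical all_reals all_analysis.
From mathcomp Require Import measurable_realfun.
Set Implicit Arguments.
Unset Strict Implicit.
Unset Printing Implicit Defensive.
Import Order.TTheory GRing.Theory Num.Theory.
Import numFieldTopology.Exports numFieldNormedType.Exports.

Local Open Scope classical_set_scope.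
Local Open Scope ring_scope.

Definition separable_space (T : topologicalType) : Prop :=
  exists2 D : set T, countable D & dense D.

Definition completely_metrizable (R : realType) (T : topologicalType) : Prop :=
  exists d : T -> T -> R,
    [/\ forall x y, 0 <= d x y,
        forall x y, d x y = 0 <-> x = y,
        forall x y, d x y = d y x &
        forall x y z, d x z <= d x y + d y z] /\
    [/\ forall (x : T) (A : set T),
          nbhs x A <-> exists2 e : R, 0 < e & [set y | d x y < e] `<=` A &
        forall u : nat -> T,
          (forall e : R, 0 < e -> exists N, forall m n,
             (N <= m)%N -> (N <= n)%N -> d (u m) (u n) < e) ->
          exists l : T, u @ \oo --> l].

Definition polish (R : realType) (T : topologicalType) : Prop :=
  separable_space T /\ completely_metrizable R T.

(* [T] with its Borel sigma-algebra. On a product, [borel (X * Y)%type] is the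
   Borel sigma-algebra of the product topology. The [ptopologicalType]
   structure only adds a base point, which the measurable types of the library
   require; a space carrying a probability measure is nonempty. *)
Notation borel T := (g_sigma_algebraType (@open T)).

Section convex_function_on_half_line.
Context {R : realType}.
Implicit Types h : R -> R.

(* A function on the half-line [0, +oo) is given by a function on [R]; only its
   values at nonnegative points are used. *)

Definition strictly_convex0y h : Prop :=
  forall x y t : R, 0 <= x -> 0 <= y -> x != y -> 0 < t < 1 ->
    h (t * x + (1 - t) * y) < t * h x + (1 - t) * h y.

(* The derivative on the half-line, extended to 0 by its right limit. *)
Definition deriv0y h (x : R) : R :=
  if 0 < x then derive1 h x else lim (derive1 h @ 0^'+).

Definition continuously_differentiable0y h : Prop :=
  [/\ {within `[0, +oo[, continuous h},
      forall x, 0 < x -> derivable h x 1 &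
      {within `[0, +oo[, continuous (deriv0y h)}].

End convex_function_on_half_line.

Section couplings.
Context {R : realType} {X Y : ptopologicalType}.
Local Open Scope ereal_scope.
Implicit Types P Q : probability (borel (X * Y)%type) R.

Definition marginal1 Q : set (borel X) -> \bar R :=
  pushforward Q (fst : borel (X * Y)%type -> borel X).

Definition marginal2 Q : set (borel Y) -> \bar R :=
  pushforward Q (snd : borel (X * Y)%type -> borel Y).

Definition cpl (mu : probability (borel X) R) (nu : probability (borel Y) R) :
    set (probability (borel (X * Y)%type) R) :=
  [set Q | (forall A, measurable A -> marginal1 Q A = mu A) /\
           (forall B, measurable B -> marginal2 Q B = nu B)].

(* When [Q `<< P], [Radon_Nikodym_SigmaFinite.f] is the everywhere finite and
   nonnegative version of the density (the one of charges, ['d Q '/d P], is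
   nonnegative only almost everywhere). *)
Definition density Q P (z : borel (X * Y)%type) : R :=
  fine (Radon_Nikodym_SigmaFinite.f Q P z).

Definition objective (h : R -> R) P Q : \bar R :=
  if `[< Q `<< P >] then \int[P]_z (h (density Q P z))%:E else +oo.

Definition optimal (h : R -> R) P mu nu Q : Prop :=
  cpl mu nu Q /\
  objective h P Q = ereal_inf [set objective h P Q' | Q' in cpl mu nu].

End couplings.

(* Main.v *)
Require Import Defs.
From HB Require Import structures.
From mathcomp Require Import all_boot all_order all_algebra.
From mathcomp Require Import all_classical all_reals all_analysis.
From mathcomp Require Import measurable_realfun.
From mathcomp Require Import ring lra.
Set Implicit Arguments.
Unset Strict Implicit.
Unset Printing Implicit Defensive.
Import Order.TTheory GRing.Theory Num.Theory.
Import numFieldTopology.Exports numFieldNormedType.Exports.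

(** Truncating both potentials to [[-n, n]] gives bounded functions [phi_n] and
    [psi_n] whose sum has the same integral against every coupling.  Since
    [t |-> max (min t n) (-n)] is odd and 1-Lipschitz, [k_n = (phi_n + psi_n)_+]
    lies between [0] and [(phi + psi)_+ = h' (Dstar)] and is eventually equal to it
    ([D] and [Dstar] are the densities of [Q] and [Qstar]).  With the conjugate [h^*],
    the Fenchel-Young inequality yields
      [\int h(D) dP >= \int (k_n D - h^*(k_n)) dP >= \int (k_n Dstar - h^*(k_n)) dP],
    because [k_n >= phi_n + psi_n], with equality where [Dstar > 0].  The last
    integrand is bounded below by [h 0] and is eventually [h(Dstar)], so that
    Fatou's lemma concludes. *)

Local Open Scope classical_set_scope.
Local Open Scope ring_scope.

(** * Tangent inequality and convex conjugate on the half-line *)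

Section tangent.
Context {R : realType}.
Variable h : R -> R.
Hypothesis h_convex : strictly_convex0y h.
Hypothesis h_C1 : continuously_differentiable0y h.
Hypothesis h'_0 : derive1 h x @[x --> 0^'+] --> (0 : R).
Hypothesis h'_y : derive1 h x @[x --> +oo%R] --> +oo%R.

Lemma deriv0y0 : deriv0y h 0 = 0.
Proof. by rewrite /deriv0y ltxx; exact/cvg_lim. Qed.

(** Convexity bounds the difference quotients of [h] at [x] in the direction [y - x] by [h y - h x];
    let the step tend to 0 from the right. *)
Lemma tangent_le_pos x y : 0 < x -> 0 <= y ->
  h x + derive1 h x * (y - x) <= h y.
Proof.
move=> x0 y0; have [->|yx] := eqVneq y x; first by rewrite subrr mulr0 addr0.
have [_ dh _] := h_C1.
have /derivable1_diffP dfh := dh _ x0.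
have /cvg_dnbhs_at_right dir := @diff_derivable _ _ _ h x (y - x) dfh.
have E : 'D_(y - x) h x = derive1 h x * (y - x).
  rewrite deriveE// derive1E'// mulrC.
  by rewrite -[X in 'd h x X](mulr1 (y - x)) -[_ * 1]/(_ *: _) linearZ.
have {}dir : t^-1 *: (h (t *: (y - x) + x) - h x) @[t --> 0^'+] -->
    derive1 h x * (y - x) by rewrite -E; exact: dir.
suff : derive1 h x * (y - x) <= h y - h x by lra.
apply: (cvgr_to_le dir); near=> t.
have t0 : 0 < t by near: t; exact: nbhs_right_gt.
have t1 : t < 1 by near: t; exact: nbhs_right_lt.
rewrite /GRing.scale/= ler_pdivrMl//.
have := h_convex y0 (ltW x0) yx (_ : 0 < t < 1); rewrite t0 t1 => /(_ isT).
have -> : t * (y - x) + x = t * y + (1 - t) * x by ring.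
lra.
Unshelve. all: by end_near. Qed.

(** The case [x = 0] is the limit of the previous inequality as [x] decreases to 0: [h] is
    continuous at 0 and its derivative tends to 0. *)
Lemma tangent_le x y : 0 <= x -> 0 <= y ->
  h x + deriv0y h x * (y - x) <= h y.
Proof.
rewrite le_eqVlt => /predU1P[<- y0|x0 y0]; last first.
  by rewrite /deriv0y x0; exact: tangent_le_pos.
rewrite deriv0y0; have [/continuous_within_itvcyP[_ h0] _ _] := h_C1.
have : h x + derive1 h x * (y - x) @[x --> 0^'+] --> h 0 + 0 * (y - 0).
  apply: cvgD => //; apply: cvgM => //; apply: cvgB; first exact: cvg_cst.
  exact: cvg_at_right_filter.
move=> /cvgr_to_le; apply; near=> t; apply: tangent_le_pos => //.
Unshelve. all: by end_near. Qed.

Lemma le_h0 x : 0 <= x -> h 0 <= h x.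
Proof.
by move=> x0; have := tangent_le (lexx 0) x0; rewrite deriv0y0 mul0r addr0.
Qed.

(** Strict convexity at the midpoint of 0 and [x] makes the minimum [h 0] strict, and the tangent at
    [x], evaluated at 0, must then have positive slope. *)
Lemma deriv0y_gt0 x : 0 < x -> 0 < deriv0y h x.
Proof.
move=> x0; have h20 : h 0 < h x.
  have := @h_convex x 0 2^-1 (ltW x0) (lexx _).
  rewrite gt_eqF// => /(_ isT); rewrite invr_gt0 ltr0n invf_lt1// ltr1n.
  move=> /(_ isT); rewrite mulr0 addr0.
  have : h 0 <= h (2^-1 * x) by apply: le_h0; rewrite mulr_ge0// ltW.
  lra.
have := tangent_le (ltW x0) (lexx 0).
rewrite sub0r mulrN => H.
by rewrite -(pmulr_lgt0 _ x0); lra.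
Qed.

Definition conj0y (k : R) : R := sup [set k * x - h x | x in [set x | 0 <= x]].

(** As the derivative tends to infinity, some tangent has slope at least [k]; it lies below [h],
    which bounds the set. This makes [sup] in [conj0y] a genuine supremum. *)
Lemma has_sup_conj0y k : has_sup [set k * x - h x | x in [set x | 0 <= x]].
Proof.
split; first by exists (k * 0 - h 0), 0 => //=.
have /cvgryPge/(_ k) h'k := h'_y.
have [x [/= x0 kx]] :=
  filter_ex (filterI (nbhs_pinfty_gt (num_real (0 : R))) h'k).
exists (derive1 h x * x - h x) => _ [y /= y0 <-].
have := tangent_le_pos x0 y0.
have : k * y <= derive1 h x * y by rewrite ler_wpM2r.
rewrite mulrBr; lra.
Qed.

Lemma fenchel_young k x : 0 <= x -> k * x <= h x + conj0y k.
Proof.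
move=> x0; rewrite -lerBlDl; apply: ub_le_sup => /=; last by exists x.
by have [] := has_sup_conj0y k.
Qed.

Lemma conj0y_le k c :
  (forall x, 0 <= x -> k * x <= h x + c) -> conj0y k <= c.
Proof.
move=> H; apply: ge_sup; first by have [] := has_sup_conj0y k.
by move=> _ [y /= /H + <-]; rewrite lerBlDl.
Qed.

Lemma conj0y_nd : {homo conj0y : k l / k <= l}.
Proof.
move=> k l kl; apply: conj0y_le => x x0.
by apply: le_trans (fenchel_young l x0); rewrite ler_wpM2r.
Qed.

(** Equality case of Fenchel-Young: by the tangent inequality the supremum is attained at [x]. *)
Lemma conj0y_deriv x : 0 <= x ->
  conj0y (deriv0y h x) = deriv0y h x * x - h x.
Proof.
move=> x0; apply/eqP; rewrite eq_le; apply/andP; split.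
  apply: conj0y_le => y y0; have := tangent_le x0 y0; rewrite mulrBr; lra.
have := fenchel_young (deriv0y h x) x0; lra.
Qed.

(* The map [k |-> k * x - conj0y k] is concave with maximum at [deriv0y h x],
   so on [[0, deriv0y h x]] it is bounded below by its value at [0]. *)
Lemma conj0y_le_below k x : 0 <= x -> 0 <= k <= deriv0y h x ->
  conj0y k + h 0 <= k * x.
Proof.
move=> x0 /andP[k0 kx]; rewrite -lerBrDr; apply: conj0y_le => y y0.
(* To the right of [x], slope [k] stays below the tangent slope; to the left, [k >= 0] and the
   minimality of [h 0] suffice. *)
have [xy|/ltW yx] := leP x y.
  have := tangent_le x0 y0; have := le_h0 x0.
  have : k * (y - x) <= deriv0y h x * (y - x).
    by rewrite ler_wpM2r// subr_ge0.
  rewrite [k * (y - x)]mulrBr; lra.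
have := le_h0 y0; have : k * y <= k * x by rewrite ler_wpM2l.
lra.
Qed.

End tangent.

(** * Truncation of extended real potentials *)

Section clip.
Context {R : realType}.
Implicit Types (n : nat) (e : \bar R).

(** The argument of [fine] is always finite, so its default value is never met; in particular [-oo]
    is sent to [- n%:R]. *)
Definition clip n e : R := fine (maxe (- n%:R)%:E (mine e n%:R%:E)).

Lemma clip_fin n (x : R) :
  clip n x%:E = Num.max (- n%:R) (Num.min x n%:R).
Proof. by rewrite /clip -EFin_min -EFin_max. Qed.

Lemma clip_fin_cases n (x : R) :
  [\/ x <= - n%:R /\ clip n x%:E = - n%:R,
      - n%:R <= x <= n%:R /\ clip n x%:E = x |
      n%:R <= x /\ clip n x%:E = n%:R].
Proof.
have n0 : - n%:R <= n%:R :> R by rewrite ge0_cp.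
rewrite clip_fin; have /orP[xn|nx] := le_total x n%:R; last first.
  by constructor 3; rewrite min_r// max_r.
rewrite min_l//; have /orP[xN|Nx] := le_total x (- n%:R).
  by constructor 1; rewrite max_l.
by constructor 2; rewrite max_r// Nx xn.
Qed.

Lemma clipNy n : clip n -oo%E = - n%:R.
Proof. by rewrite /clip minNye maxeNy. Qed.

Lemma clip_le n e : clip n e <= n%:R.
Proof.
have n0 : 0 <= n%:R :> R by [].
case: e => [x| |]; rewrite ?clipNy ?clip_fin.
- by rewrite ge_max ge_min lexx orbT andbT; lra.
- by rewrite /clip minye -EFin_max/= ge_max lexx andbT; lra.
- by lra.
Qed.

Lemma clipN_le n e : - n%:R <= clip n e.
Proof.
case: e => [x| |]; rewrite ?clipNy ?clip_fin//.
- by rewrite le_max lexx.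
- by rewrite /clip minye -EFin_max/= le_max lexx.
Qed.

Lemma measurable_clip n : measurable_fun [set: \bar R] (clip n).
Proof.
apply: measurableT_comp; first exact: fine_measurable.
by apply: measurable_maxe => //; apply: measurable_mine.
Qed.

(* Clipping is odd and nonexpanding, so [clip n x + clip n y] has the sign of
   [x + y] and is not larger in absolute value. *)
Lemma clipD_le n e1 e2 (d : R) : (e1 < +oo)%E -> (e2 < +oo)%E ->
  d%:E = maxe (e1 + e2)%E 0%E -> Num.max (clip n e1 + clip n e2) 0 <= d.
Proof.
have n0 : 0 <= n%:R :> R by [].
move=> e1y e2y de; have d0 : 0 <= d by rewrite -lee_fin de le_max lexx orbT.
rewrite ge_max d0 andbT.
have C1 := clip_le n e1; have C2 := clip_le n e2.
move: e1 e2 e1y e2y de C1 C2 => [x| |] [y| |] // _ _; rewrite ?clipNy.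
- rewrite -EFinD -EFin_max => -[->] _ _.
  by case: (clip_fin_cases n x) => -[? ->]; case: (clip_fin_cases n y) => -[? ->];
    case: (leP (x + y) 0) => ?; lra.
- by lra.
- by lra.
- by lra.
Qed.

(** A positive [d] forces both potentials to be finite with positive sum; clipping is odd and
    monotone, so it preserves [- y <= x]. *)
Lemma clipD_ge0 n e1 e2 (d : R) : (e1 < +oo)%E -> (e2 < +oo)%E ->
  d%:E = maxe (e1 + e2)%E 0%E -> 0 < d -> 0 <= clip n e1 + clip n e2.
Proof.
have n0 : 0 <= n%:R :> R by [].
move: e1 e2 => [x| |] [y| |] // _ _; last 3 first.
- by rewrite addeNy maxNye => -[->]; rewrite ltxx.
- by rewrite addNye maxNye => -[->]; rewrite ltxx.
- by rewrite addNye maxNye => -[->]; rewrite ltxx.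
rewrite -EFinD -EFin_max => -[->]; rewrite lt_max ltxx orbF => xy.
by case: (clip_fin_cases n x) => -[? ->]; case: (clip_fin_cases n y) => -[? ->];
  lra.
Qed.

Lemma clipD_near e1 e2 (d : R) : (e1 < +oo)%E -> (e2 < +oo)%E ->
  d%:E = maxe (e1 + e2)%E 0%E ->
  \forall n \near \oo, Num.max (clip n e1 + clip n e2) 0 = d.
Proof.
move=> e1y e2y de; have : 0 <= d by rewrite -lee_fin de le_max lexx orbT.
(* If [d = 0], a potential may be [-oo] and its truncations never stabilise, but [clipD_le] squeezes
   the positive part to 0. If [d > 0], both are finite and clipping eventually does nothing. *)
rewrite le_eqVlt => /predU1P[d0|d_gt0].
  apply: nearW => n; apply/eqP; rewrite eq_le (clipD_le n e1y e2y de)/=.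
  by rewrite -d0 le_max lexx orbT.
move: e1 e2 e1y e2y de => [x| |] [y| |] // _ _; last 3 first.
- by rewrite addeNy maxNye => -[d0]; rewrite d0 ltxx in d_gt0.
- by rewrite addNye maxNye => -[d0]; rewrite d0 ltxx in d_gt0.
- by rewrite addNye maxNye => -[d0]; rewrite d0 ltxx in d_gt0.
rewrite -EFinD -EFin_max => -[->]; near=> n.
have : `|x| <= n%:R by near: n; exact: nbhs_infty_ger.
have : `|y| <= n%:R by near: n; exact: nbhs_infty_ger.
rewrite !ler_norml => /andP[y1 y2] /andP[x1 x2].
by rewrite !clip_fin (min_l x2) (min_l y2) (max_r x1) (max_r y1).
Unshelve. all: by end_near. Qed.

End clip.

(** * Integrals against couplings and their densities *)

Section coupling_integrals.
Context {R : realType} {X Y : ptopologicalType}.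
Local Open Scope ereal_scope.
Implicit Types P Q : probability (borel (X * Y)%type) R.

Lemma measurable_fst_borel :
  measurable_fun [set: borel (X * Y)%type]
    (fst : borel (X * Y)%type -> borel X).
Proof.
apply: (@measurability _ _ (borel (X * Y)%type) (borel X) setT
  (fst : borel (X * Y)%type -> borel X) (@open X) erefl).
move=> _ [A oA <-]; rewrite setTI; apply: sub_sigma_algebra.
by apply: open_comp oA => z _; exact: cvg_fst.
Qed.

Lemma measurable_snd_borel :
  measurable_fun [set: borel (X * Y)%type]
    (snd : borel (X * Y)%type -> borel Y).
Proof.
apply: (@measurability _ _ (borel (X * Y)%type) (borel Y) setT
  (snd : borel (X * Y)%type -> borel Y) (@open Y) erefl).
move=> _ [A oA <-]; rewrite setTI; apply: sub_sigma_algebra.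
by apply: open_comp oA => z _; exact: cvg_snd.
Qed.

Lemma integral_cpl (mu : probability (borel X) R) (nu : probability (borel Y) R)
    Q (a : borel X -> \bar R) (b : borel Y -> \bar R) :
  cpl mu nu Q -> (forall x, 0 <= a x) -> (forall y, 0 <= b y) ->
  measurable_fun [set: borel X] a -> measurable_fun [set: borel Y] b ->
  \int[Q]_z (a z.1 + b z.2) = \int[mu]_x a x + \int[nu]_y b y.
Proof.
move=> [Q1 Q2] a0 b0 ma mb.
have m1 := measurable_fst_borel; have m2 := measurable_snd_borel.
rewrite ge0_integralD//; [|exact: (measurableT_comp ma m1)|exact: (measurableT_comp mb m2)].
congr (_ + _).
- transitivity (\int[pushforward Q (fst : borel (X * Y)%type -> borel X)]_x a x).
    by rewrite (ge0_integral_pushforward m1)// => x _; exact: a0.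
  by apply: eq_measure_integral => A mA _; exact: Q1.
- transitivity (\int[pushforward Q (snd : borel (X * Y)%type -> borel Y)]_y b y).
    by rewrite (ge0_integral_pushforward m2)// => y _; exact: b0.
  by apply: eq_measure_integral => A mA _; exact: Q2.
Qed.

Section density.
Variables P Q : probability (borel (X * Y)%type) R.
Hypothesis QP : Q `<< P.

Lemma density_ge0 z : (0 <= density Q P z)%R.
Proof. exact/fine_ge0/Radon_Nikodym_SigmaFinite.f_ge0. Qed.

Lemma measurable_density : measurable_fun setT (density Q P).
Proof.
apply: measurableT_comp; first exact: fine_measurable.
exact: measurable_int (Radon_Nikodym_SigmaFinite.f_integrable QP).
Qed.

Lemma integral_density (f : borel (X * Y)%type -> \bar R) :
  (forall z, 0 <= f z) -> measurable_fun setT f ->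
  \int[P]_z (f z * (density Q P z)%:E) = \int[Q]_z f z.
Proof.
move=> f0 mf; rewrite -(Radon_Nikodym_SigmaFinite.change_of_variables QP)//.
apply: eq_integral => z _; rewrite fineK//.
exact: Radon_Nikodym_SigmaFinite.f_fin_num.
Qed.

End density.

(** The right-hand side depends on the marginals only, so one coupling can be exchanged for another
    under the integral. *)
Lemma integral_density_cpl P Q
    (mu : probability (borel X) R) (nu : probability (borel Y) R)
    (a : borel X -> \bar R) (b : borel Y -> \bar R) :
  Q `<< P -> cpl mu nu Q -> (forall x, 0 <= a x) -> (forall y, 0 <= b y) ->
  measurable_fun [set: borel X] a -> measurable_fun [set: borel Y] b ->
  \int[P]_z ((a z.1 + b z.2) * (density Q P z)%:E) =
  \int[mu]_x a x + \int[nu]_y b y.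
Proof.
move=> QP cQ a0 b0 ma mb; rewrite -(integral_cpl cQ)//.
apply: (integral_density QP) => [z|]; first exact: adde_ge0.
by apply: emeasurable_funD;
  [exact: (measurableT_comp ma measurable_fst_borel)|
   exact: (measurableT_comp mb measurable_snd_borel)].
Qed.

End coupling_integrals.

(** * Auxiliary facts on integrals and lower limits *)

(** This reduces comparisons of integrands bounded below to nonnegative ones. Unless the integral of
    [g] is [+oo], [g] is integrable, hence so are [g - c] and [f - c], and the finite integral of
    [c] can be added back. *)
Lemma le_integral_shift d (T : measurableType d) (R : realType)
    (mu : {finite_measure set T -> \bar R}) (c : R) (f g : T -> R) :
  measurable_fun setT f -> measurable_fun setT g ->
  (forall x, c <= f x) -> (forall x, c <= g x) ->
  (\int[mu]_x (f x - c)%:E <= \int[mu]_x (g x - c)%:E)%E ->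
  (\int[mu]_x (f x)%:E <= \int[mu]_x (g x)%:E)%E.
Proof.
move=> mf mg cf cg fg.
have ic : mu.-integrable setT (EFin \o cst c).
  exact: finite_measure_integrable_cst.
(* The negative part of [g] is dominated by the constant [|c|]. *)
have icg : mu.-integrable setT (fun x => (Num.max (- g x) 0)%:E).
  apply: (@le_integrable _ _ _ _ _ _ _ (EFin \o cst c)) => //.
    apply/measurable_EFinP; apply: measurable_maxr => //.
    exact: measurableT_comp.
  move=> x _ /=; rewrite lee_fin ger0_norm ?le_max ?lexx ?orbT// ge_max.
  by rewrite normr_ge0 andbT -normrN (le_trans _ (ler_norm _))// lerN2.
have [->|goo] := eqVneq (\int[mu]_x (g x)%:E)%E +oo%E; first exact: leey.
have ig : mu.-integrable setT (EFin \o g).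
  have negE : (\int[mu]_x (EFin \o g)^\- x =
      \int[mu]_x (Num.max (- g x) 0)%:E)%E.
    by apply: eq_integral => x _; rewrite funenegE /= EFin_max.
  have negfin : (\int[mu]_x (EFin \o g)^\- x \is a fin_num)%E.
    by rewrite negE; exact: integrable_fin_num icg.
  have mgE : measurable_fun setT (EFin \o g) by exact/measurable_EFinP.
  apply/integrableP; split => //.
  rewrite -[X in integral _ _ X]/(abse \o (EFin \o g)) fune_abse.
  rewrite ge0_integralD//; [|exact: measurable_funepos|exact: measurable_funeneg].
  apply: lte_add_pinfty; last by rewrite ltey_eq negfin.
  rewrite ltey; apply: contra goo => /eqP goo.
  rewrite integralE [X in (X - _)%E]goo addye//.
  by move: negfin; rewrite -fin_numN fin_numE => /andP[].
have igc : mu.-integrable setT (fun x => (g x - c)%:E).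
  by rewrite (_ : (fun _ => _) = (EFin \o g) \- (EFin \o cst c))%E;
    [exact: integrableB|apply/funext => x].
have ifc : mu.-integrable setT (fun x => (f x - c)%:E).
  apply/integrableP; split.
    by apply/measurable_EFinP; exact: measurable_funB.
  apply: le_lt_trans (le_trans _ fg) _.
    rewrite le_eqVlt; apply/orP; left; apply/eqP; apply: eq_integral => x _.
    by rewrite /= ger0_norm// subr_ge0.
  by rewrite ltey_eq (integrable_fin_num _ igc).
have E (u : T -> R) : mu.-integrable setT (fun x => (u x - c)%:E) ->
    (\int[mu]_x (u x)%:E =
     \int[mu]_x (u x - c)%:E + \int[mu]_x (cst c x)%:E)%E.
  move=> iu; rewrite -(integralD _ iu ic)//.
  by apply: eq_integral => x _; rewrite /= -EFinD subrK.
by rewrite (E f)// (E g)// leeD2r.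
Qed.

Lemma limn_einf_le (R : realType) (u : (\bar R)^nat) (c : \bar R) :
  (forall n, (u n <= c)%E) -> (limn_einf u <= c)%E.
Proof.
move=> uc; rewrite limn_einf_lim; apply: lime_le; first exact: is_cvg_einfs.
by apply: nearW => n; apply: le_trans (uc n); apply: ereal_inf_lbound; exists n => /=.
Qed.

Lemma integral_probability_cst d (T : measurableType d) (R : realType)
    (P : probability T R) (r : \bar R) : (\int[P]_x r = r)%E.
Proof.
rewrite (integral_cst P measurableT r) -[RHS]mule1; congr (_ * _)%E.
exact: probability_setT.
Qed.

Lemma measurable_fun_limn_einf d (T : measurableType d) (R : realType)
    (D : set T) (f : (T -> \bar R)^nat) : (forall n, measurable_fun D (f n)) ->
  measurable_fun D (fun x => limn_einf (f ^~ x)).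
Proof.
move=> mf.
rewrite (_ : (fun _ => _) =
    fun x => (- limn_esup ((fun n y => - f n y) ^~ x))%E).
  apply: measurableT_comp => //; apply: measurable_fun_limn_esup => n.
  exact: measurableT_comp.
apply/funext => x; have := limn_esupN (f ^~ x).
by rewrite /comp => ->; rewrite oppeK.
Qed.

(** * Comparison of the two couplings through truncated dual integrands *)

Section duality.
Context {R : realType} {X Y : ptopologicalType}.
Variables P Qstar Q : probability (borel (X * Y)%type) R.
Variables (mu : probability (borel X) R) (nu : probability (borel Y) R).
Variable h : R -> R.
Hypothesis h_convex : strictly_convex0y h.
Hypothesis h_C1 : continuously_differentiable0y h.
Hypothesis h'_0 : derive1 h x @[x --> 0^'+] --> (0 : R).
Hypothesis h'_y : derive1 h x @[x --> +oo%R] --> +oo%R.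
Hypothesis Qstar_cpl : cpl mu nu Qstar.
Hypothesis QstarP : Qstar `<< P.
Hypothesis Q_cpl : cpl mu nu Q.
Hypothesis QP : Q `<< P.
Variables (phi : borel X -> \bar R) (psi : borel Y -> \bar R).
Hypothesis phi_meas : measurable_fun [set: borel X] phi.
Hypothesis psi_meas : measurable_fun [set: borel Y] psi.
Hypothesis phi_lty : forall x, (phi x < +oo)%E.
Hypothesis psi_lty : forall y, (psi y < +oo)%E.
Hypothesis h'_density : {ae P, forall z : borel (X * Y)%type,
  (deriv0y h (density Qstar P z))%:E = maxe (phi z.1 + psi z.2)%E 0%E}.

Lemma measurable_h_density (Q' : probability (borel (X * Y)%type) R) :
  Q' `<< P -> measurable_fun setT (h \o density Q' P).
Proof.
(* Continuity of [h] is known on the half-line only, so the composition goes through that set, where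
   the density takes its values. *)
move=> Q'P; apply: (@measurable_comp _ _ _ _ (measurableTypeR R) (measurableTypeR R)
  `[0, +oo[%classic) => //.
- by move=> _ [z _ <-] /=; rewrite in_itv/= andbT density_ge0.
- apply: subspace_continuous_measurable_fun => //.
  by have [] := h_C1.
- exact: measurable_density.
Qed.

Lemma h0_le_h_density (Q' : probability (borel (X * Y)%type) R) z :
  Q' `<< P -> h 0 <= h (density Q' P z).
Proof. by move=> Q'P; apply: le_h0 => //; exact: density_ge0. Qed.

Definition clipped n (z : borel (X * Y)%type) : R :=
  Num.max (clip n (phi z.1) + clip n (psi z.2)) 0.

Lemma clipped_ge0 n z : 0 <= clipped n z.
Proof. by rewrite le_max lexx orbT. Qed.

Lemma clipped_le n z : clipped n z <= n%:R + n%:R.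
Proof. by rewrite ge_max lerD ?clip_le//= addr_ge0. Qed.

Lemma measurable_clipped n : measurable_fun setT (clipped n).
Proof.
apply: measurable_maxr => //; apply: measurable_funD.
- exact: (measurableT_comp (measurableT_comp (measurable_clip n) phi_meas)
    measurable_fst_borel).
- exact: (measurableT_comp (measurableT_comp (measurable_clip n) psi_meas)
    measurable_snd_borel).
Qed.

(** Adding [h 0] makes the conjugate nonnegative, by Fenchel-Young at 0, and matches the shift of
    [h] by its minimum. *)
Definition gap n z : R := conj0y h (clipped n z) + h 0.

Lemma gap_ge0 n z : 0 <= gap n z.
Proof.
have := fenchel_young h_convex h_C1 h'_y (clipped n z) (lexx 0).
by rewrite mulr0 addrC.
Qed.

Lemma measurable_gap n : measurable_fun setT (gap n).
Proof.
apply: measurable_funD => //.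
apply: (measurableT_comp _ (measurable_clipped n)).
by apply: nondecreasing_measurable => //; exact: conj0y_nd.
Qed.

(** The conjugate is monotone and [clipped n] is at most [2 n], so [gap n] is bounded. Finiteness
    allows this integral to be cancelled later. *)
Lemma integral_gap_fin n : (\int[P]_z (gap n z)%:E \is a fin_num)%E.
Proof.
rewrite ge0_fin_numE; last first.
  by apply: integral_ge0 => z _; rewrite lee_fin gap_ge0.
apply: (@le_lt_trans _ _
    (\int[P]_z (conj0y h (n%:R + n%:R) + h 0)%:E)%E); last first.
  by rewrite integral_probability_cst ltry.
apply: ge0_le_integral => //.
- by move=> z _; rewrite lee_fin; exact: gap_ge0.
- by apply/measurable_EFinP; exact: measurable_gap.
- move=> z _; rewrite lee_fin lerD2r.
  by apply: conj0y_nd => //; exact: clipped_le.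
Qed.

(** Where the density equation holds, the difference is already nonnegative by [conj0y_le_below];
    the maximum extends this to the exceptional null set. *)
Definition dual n z : R :=
  Num.max (clipped n z * density Qstar P z - gap n z) 0.

Lemma measurable_dual n : measurable_fun setT (dual n).
Proof.
apply: measurable_maxr => //; apply: measurable_funB; last exact: measurable_gap.
apply: measurable_funM; [exact: measurable_clipped|exact: measurable_density].
Qed.

(** Eventually [clipped n z] is the derivative at the density, where Fenchel-Young is an
    equality. *)
Lemma dual_near z :
  (deriv0y h (density Qstar P z))%:E = maxe (phi z.1 + psi z.2)%E 0%E ->
  \forall n \near \oo, dual n z = h (density Qstar P z) - h 0.
Proof.
move=> dz; have D0 := density_ge0 QstarP z.
near=> n; have E : clipped n z = deriv0y h (density Qstar P z).
  by near: n; exact: clipD_near.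
rewrite /dual /gap E conj0y_deriv// max_l; first by lra.
have := h0_le_h_density z QstarP; lra.
Unshelve. all: by end_near. Qed.

(* Shifting the clipped potentials by [n] makes all integrands nonnegative. *)
Lemma integral_dual_le n :
  (\int[P]_z (dual n z)%:E <= \int[P]_z (h (density Q P z) - h 0)%:E)%E.
Proof.
have n0 : 0 <= n%:R :> R by [].
pose a (x : borel X) : \bar R := (clip n (phi x) + n%:R)%:E.
pose b (y : borel Y) : \bar R := (clip n (psi y) + n%:R)%:E.
have a0 x : (0 <= a x)%E.
  by rewrite lee_fin; have := clipN_le n (phi x); lra.
have b0 y : (0 <= b y)%E.
  by rewrite lee_fin; have := clipN_le n (psi y); lra.
have ma : measurable_fun [set: borel X] a.
  apply/measurable_EFinP; apply: measurable_funD => //.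
  exact: (measurableT_comp (measurable_clip n) phi_meas).
have mb : measurable_fun [set: borel Y] b.
  apply/measurable_EFinP; apply: measurable_funD => //.
  exact: (measurableT_comp (measurable_clip n) psi_meas).
have intD (Q' : probability (borel (X * Y)%type) R) : Q' `<< P ->
    (\int[P]_z ((n%:R + n%:R)%:E * (density Q' P z)%:E) = (n%:R + n%:R)%:E)%E.
  move=> Q'P; rewrite (@integral_density _ _ _ _ _ Q'P (cst (n%:R + n%:R)%:E))//.
    exact: integral_probability_cst.
  by move=> z; rewrite /= lee_fin addr_ge0.
have mnD (Q' : probability (borel (X * Y)%type) R) : Q' `<< P ->
    measurable_fun setT (fun z => ((n%:R + n%:R)%:E * (density Q' P z)%:E)%E).
  move=> Q'P; apply: emeasurable_funM => //.
  by apply/measurable_EFinP; exact: measurable_density Q'P.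
have mabD (Q' : probability (borel (X * Y)%type) R) : Q' `<< P ->
    measurable_fun setT (fun z : borel (X * Y)%type => ((a z.1 + b z.2) * (density Q' P z)%:E)%E).
  move=> Q'P; apply: emeasurable_funM.
    by apply: emeasurable_funD;
      [exact: (measurableT_comp ma measurable_fst_borel)|
       exact: (measurableT_comp mb measurable_snd_borel)].
  by apply/measurable_EFinP; exact: measurable_density.
have nD0 (Q' : probability (borel (X * Y)%type) R) z : Q' `<< P ->
    (0 <= (n%:R + n%:R)%:E * (density Q' P z)%:E)%E.
  by move=> Q'P; rewrite mule_ge0// lee_fin ?density_ge0// addr_ge0.
have abD0 (Q' : probability (borel (X * Y)%type) R) z : Q' `<< P ->
    (0 <= (a z.1 + b z.2) * (density Q' P z)%:E)%E.
  by move=> Q'P; rewrite mule_ge0// ?adde_ge0// lee_fin density_ge0.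
have mgE : measurable_fun setT (fun z => (gap n z)%:E).
  by apply/measurable_EFinP; exact: measurable_gap.
have mdE : measurable_fun setT (fun z => (dual n z)%:E).
  by apply/measurable_EFinP; exact: measurable_dual.
have mhE : measurable_fun setT (fun z => (h (density Q P z) - h 0)%:E).
  apply/measurable_EFinP; apply: measurable_funB => //.
  exact: measurable_h_density.
have g0 z : (0 <= (gap n z)%:E)%E by rewrite lee_fin gap_ge0.
have d0 z : (0 <= (dual n z)%:E)%E by rewrite lee_fin le_max lexx orbT.
have hD0 z : (0 <= (h (density Q P z) - h 0)%:E)%E.
  by rewrite lee_fin subr_ge0 h0_le_h_density.
(* The shift by [n] of both potentials costs [2 n] times a density, whose integral is [2 n] for
   either coupling; with the gap it forms a finite amount added to both sides. *)
have splitE (Q' : probability (borel (X * Y)%type) R)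
    (f : borel (X * Y)%type -> \bar R) : Q' `<< P -> (forall z, 0 <= f z)%E ->
    measurable_fun setT f ->
    (\int[P]_z f z + (\int[P]_z (gap n z)%:E + (n%:R + n%:R)%:E) =
     \int[P]_z (f z + (gap n z)%:E + (n%:R + n%:R)%:E * (density Q' P z)%:E))%E.
  move=> Q'P f0 mf; rewrite ge0_integralD//.
  - by rewrite ge0_integralD// intD// addeA.
  - by move=> z _; exact: adde_ge0.
  - exact: emeasurable_funD.
  - by move=> z _; exact: nD0.
  - exact: mnD.
rewrite -(@leeD2rE _ (\int[P]_z (gap n z)%:E + (n%:R + n%:R)%:E)); last first.
  by rewrite fin_numD integral_gap_fin.
rewrite (splitE Qstar)// (splitE Q)//.
apply: (@le_trans _ _ (\int[P]_z ((a z.1 + b z.2) * (density Qstar P z)%:E)))%E.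
  apply: ae_ge0_le_integral => //.
  - by move=> z _; rewrite !adde_ge0// nD0.
  - by apply: emeasurable_funD; [exact: emeasurable_funD|exact: mnD].
  - by move=> z _; exact: abD0.
  - exact: mabD.
  move: h'_density; apply: filterS => z dz _.
  have D0 := density_ge0 QstarP z.
  have kd : clipped n z <= deriv0y h (density Qstar P z) by exact: clipD_le.
  rewrite /a /b -!(EFinD, EFinM) lee_fin /dual max_l; last first.
    rewrite subr_ge0; apply: conj0y_le_below => //.
    by rewrite clipped_ge0.
  (* Where the density of [Qstar] vanishes, the products vanish; where it is positive, so is the
     derivative, and the positive part in [clipped] is inactive. *)
  move: D0; rewrite le_eqVlt => /predU1P[<-|D0]; first by rewrite !mulr0; lra.
  have : 0 <= clip n (phi z.1) + clip n (psi z.2).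
    apply: clipD_ge0 dz _ => //; exact: deriv0y_gt0.
  by rewrite /clipped => /max_l ->; lra.
(* Exchange [Qstar] for [Q] through the common marginals. *)
rewrite (integral_density_cpl QstarP Qstar_cpl)//.
rewrite -(integral_density_cpl QP Q_cpl)//.
apply: ge0_le_integral => //.
- by move=> z _; exact: abD0.
- exact: mabD.
- by apply: emeasurable_funD; [exact: emeasurable_funD|exact: mnD].
move=> z _; have D0 := density_ge0 QP z.
have FY := fenchel_young h_convex h_C1 h'_y (clipped n z) D0.
have : (clip n (phi z.1) + clip n (psi z.2)) * density Q P z <=
    clipped n z * density Q P z.
  by rewrite ler_wpM2r// le_max lexx.
by rewrite /a /b -!(EFinD, EFinM) lee_fin /gap; lra.
Qed.

Lemma integral_h_density_le :
  (\int[P]_z (h (density Qstar P z))%:E <= \int[P]_z (h (density Q P z))%:E)%E.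
Proof.
apply: (@le_integral_shift _ _ _ _ (h 0)); do ?exact: measurable_h_density.
- by move=> z; exact: h0_le_h_density.
- by move=> z; exact: h0_le_h_density.
have md n : measurable_fun setT (fun z => (dual n z)%:E).
  by apply/measurable_EFinP; exact: measurable_dual.
have d0 n z : (0 <= (dual n z)%:E)%E by rewrite lee_fin le_max lexx orbT.
apply: le_trans (limn_einf_le integral_dual_le).
apply: le_trans (fatou P measurableT md (fun n z _ => d0 n z)).
rewrite le_eqVlt; apply/orP; left; apply/eqP; apply: ae_eq_integral => //.
- apply/measurable_EFinP; apply: measurable_funB => //.
  exact: measurable_h_density.
- exact: measurable_fun_limn_einf.
(* Almost everywhere [dual n z] is eventually constant in [n], so its lower limit is the shifted
   integrand. *)
move: h'_density; apply: filterS => z dz _.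
apply/esym; apply: (cvg_limn_einf_sup _).1.
apply: cvg_near_cst.
by have := dual_near dz; apply: filterS => n ->.
Qed.

End duality.

Theorem theorem1p6 (R : realType) (X Y : ptopologicalType)
    (polishX : polish R X) (polishY : polish R Y)
    (P : probability (borel (X * Y)%type) R)
    (mu : probability (borel X) R) (nu : probability (borel Y) R)
    (muP : mu `<< marginal1 P) (nuP : nu `<< marginal2 P)
    (h : R -> R)
    (h_convex : strictly_convex0y h)
    (h_bounded : exists m : R, forall x : R, 0 <= x -> m <= h x)
    (h_C1 : continuously_differentiable0y h)
    (h'_0 : derive1 h x @[x --> 0^'+] --> (0 : R))
    (h'_y : derive1 h x @[x --> +oo%R] --> +oo%R)
    (h_doubling : exists a b c : R, forall x : R, 0 <= x ->
       h (2 * x) <= a * h x + b * x + c)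
    (Qstar : probability (borel (X * Y)%type) R)
    (Qstar_cpl : cpl mu nu Qstar) (QstarP : Qstar `<< P)
    (phi : borel X -> \bar R) (psi : borel Y -> \bar R)
    (phi_meas : measurable_fun [set: borel X] phi)
    (psi_meas : measurable_fun [set: borel Y] psi)
    (phi_lty : forall x, (phi x < +oo)%E) (psi_lty : forall y, (psi y < +oo)%E)
    (h'_density : {ae P, forall z : borel (X * Y)%type,
       (deriv0y h (density Qstar P z))%:E = maxe (phi z.1 + psi z.2)%E 0%E}) :
  optimal h P mu nu Qstar.
Proof.
split=> //; apply/eqP; rewrite eq_le; apply/andP; split; last first.
  by apply: ereal_inf_lbound; exists Qstar.
apply/ereal_infP => _ [Q Qcpl <-]; rewrite /objective asboolT//.
(* A competitor that is not absolutely continuous has objective [+oo]. *)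
case: asboolP => [QP|_]; last exact: leey.
exact: (integral_h_density_le h_convex h_C1 h'_0 h'_y Qstar_cpl QstarP Qcpl QP
  phi_meas psi_meas phi_lty psi_lty h'_density).
Qed.
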